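(* Let $m,n,k,l$ be integers with $1\le k\le \min\{m,n\}$ and $0\le l\le k$. Let $\#(m,n,k,l)$ denote the number of lattice paths $\gamma\in\Gamma_{m,n}$ with $k$-horizontal exceedance $HE_k(\gamma)=l$. Then $$\#(m,n,k,l)=\sum_{j=0}^{k-1} I(\{j\ge l\})\,|B_{(j,k)}(l)|+\sum_{j=0}^{k-1} I(\{j\ge k-l\})\,|B_{(k,j)}(l)|,$$ where $I$ is the indicator function (equal to $1$ if the condition holds and $0$ otherwise) and the numbers $|B_{(k,j)}(l)|$, $|B_{(j,k)}(l)|$ are given by $$|B_{(k,j)}(l)|=\binom{m+n-k-j}{m-k}\sum_{i=k-l}^{j} C_i\, b(k-1-i,\,j-i),\qquad 0\le j<k-1,$$ $$|B_{(j,k)}(l)|=\binom{m+n-k-j}{n-k}\sum_{i=l}^{j} C_i\, b(k-1-i,\,j-i),\qquad 0\le j<k-1,$$ $$|B_{(k-1,k)}(l)|=\binom{m+n-2k+1}{n-k}\,C_{k-1},\qquad |B_{(k,k-1)}(l)|=\binom{m+n-2k+1}{m-k}\,C_{k-1}.$$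
   Context: A lattice path in $\mathbb{N}^2$ (with $0\in\mathbb{N}$) starts at $(0,0)$ and takes unit steps $(1,0)$ (right, a horizontal edge) and $(0,1)$ (up, a vertical edge). $\Gamma_{m,n}$ is the set of lattice paths from $(0,0)$ to $(m,n)$. The $k$-horizontal exceedance $HE_k(\gamma)$ of $\gamma\in\Gamma_{m,n}$ is the number of the first $k$ horizontal edges of $\gamma$ that lie below the line $y=x$ (a horizontal edge from $(a-1,c)$ to $(a,c)$ lies below $y=x$ iff $c\le a-1$). $C_i=\frac{1}{i+1}\binom{2i}{i}$ is the $i$-th Catalan number. For integers $p>q\ge 0$, the ballot number $b(p,q)$ is the number of lattice paths from $(0,0)$ to $(p,q)$ that stay strictly below the line $y=x$ except at $(0,0)$; $b(p,q)=\frac{p-q}{p+q}\binom{p+q}{q}$. Empty sums are $0$. *)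

(* Defs.v *)
From mathcomp Require Import all_boot.

Set Implicit Arguments.
Unset Strict Implicit.
Unset Printing Implicit Defensive.

(** A lattice path is its word of steps: [true] is the right step (1,0) and
    [false] is the up step (0,1). *)

Definition move (v : nat * nat) (s : bool) : nat * nat :=
  if s then (v.1.+1, v.2) else (v.1, v.2.+1).

Definition path_end (g : seq bool) : nat * nat := foldl move (0, 0) g.

(** [scanl] omits the origin: these are the vertices of [g] other than its
    starting point. *)
Definition later_vertices (g : seq bool) : seq (nat * nat) :=
  scanl move (0, 0) g.

(** Every path ending at (m,n) has exactly m + n steps. *)
Definition Gamma (m n : nat) : {set (m + n).-tuple bool} :=
  [set g : (m + n).-tuple bool | path_end g == (m, n)].

(** The left endpoints (a-1,c) of the horizontal edges of [g], in the order in
    which [g] traverses them: [mask] keeps the vertices followed by a right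
    step. *)
Definition hedges (g : seq bool) : seq (nat * nat) :=
  mask g ((0, 0) :: later_vertices g).

Definition hedge_below (v : nat * nat) : bool := v.2 <= v.1.

Definition HE (k : nat) (g : seq bool) : nat :=
  count hedge_below (take k (hedges g)).

Definition catalan (i : nat) : nat := 'C(2 * i, i) %/ i.+1.

(** The division in [catalan] is exact. *)
Lemma catalanE (i : nat) : i.+1 * catalan i = 'C(2 * i, i).
Proof.
rewrite /catalan mulnC divnK //.
have /eqP E : i.+1 * 'C(2 * i, i.+1) == i * 'C(2 * i, i).
  by rewrite mul_bin_left mul2n -addnn addnK.
have D : i.+1 %| i * 'C(2 * i, i) by rewrite -E dvdn_mulr.
by rewrite -(@Gauss_dvdr _ i) // coprimeSn.
Qed.

(** Between consecutive vertices a path stays strictly below y = x as soon as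
    the later of the two vertices does and the earlier one is not above the
    line, so the condition is checked on vertices only. *)
Definition ballot (p q : nat) : nat :=
  #|[set g in Gamma p q | all (fun v => v.2 < v.1) (later_vertices g)]|.

(** [B_kj m n k j l] and [B_jk m n j k l] are the numbers |B_(k,j)(l)| and
    |B_(j,k)(l)|, for 0 <= j <= k-1, 0 <= l <= k and 1 <= k <= min(m,n); in
    this range no subtraction below truncates. *)

Definition B_kj (m n k j l : nat) : nat :=
  if j == k - 1 then 'C(m + n - 2 * k + 1, m - k) * catalan (k - 1)
  else 'C(m + n - k - j, m - k)
       * \sum_(k - l <= i < j.+1) catalan i * ballot (k - 1 - i) (j - i).

Definition B_jk (m n j k l : nat) : nat :=
  if j == k - 1 then 'C(m + n - 2 * k + 1, n - k) * catalan (k - 1)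
  else 'C(m + n - k - j, n - k)
       * \sum_(l <= i < j.+1) catalan i * ballot (k - 1 - i) (j - i).

(* Main.v *)
(** Everything is counted by removing the last step of a path. The sum over the
    last visit (i,i) to the diagonal of [w i] times a ballot number satisfies
    the Pascal recursion strictly below the diagonal, for any weight [w].
    - For [w i = 'C(2i,i)] this gives ['C(x+y,y)]; taking (x,y) = (n+1,n) and
      symmetrizing the sum yields the Catalan convolution.
    - For [w i = I(r <= i) C_i] it counts the paths to (x,y), y <= x, having
      exactly r horizontal edges above the line; by reflection it also counts,
      with r the number of edges below, the paths ending above the line. The
      Catalan convolution is what makes the two sides agree on the diagonal
      (a form of the Chung-Feller theorem).
    The right-hand side of the theorem satisfies the Pascal recursion in (m,n)
    for m, n > k, so it remains to compare both sides for m = k and n = k. *)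

Require Import Defs.
From mathcomp Require Import all_boot zify.

Set Implicit Arguments.
Unset Strict Implicit.
Unset Printing Implicit Defensive.

(** * Counting paths by their last step *)

Lemma card_tuple_rcons (N : nat) (P : pred (seq bool)) :
  #|[set g : N.+1.-tuple bool | P g]| =
    #|[set g : N.-tuple bool | P (rcons g true)]|
    + #|[set g : N.-tuple bool | P (rcons g false)]|.
Proof.
pose ext (b : bool) (g : N.-tuple bool) := [tuple of rcons g b].
have ext_inj b : injective (ext b).
  by move=> g h /(congr1 val) /= /rcons_inj [/val_inj].
rewrite -(card_imset _ (@ext_inj true)) -(card_imset _ (@ext_inj false)).
rewrite -cardsUI; set A := [set ext true x | x in _].
set B := [set ext false x | x in _].
have /eqP : A :&: B = set0.
  apply/setP => g; rewrite !inE; apply/negP => /andP[/imsetP[h _ ->]].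
  by case/imsetP => h' _ /(congr1 val) /= /rcons_inj [].
rewrite -cards_eq0 => /eqP ->; rewrite addn0.
apply: eq_card => g; rewrite !inE; apply/idP/orP; last first.
  by case=> /imsetP[h]; rewrite inE => Ph ->.
move: (valP g) => /eqP; case/lastP E : (val g) => [//|u b].
rewrite size_rcons => -[su] Pg.
have eu : size u == N by apply/eqP.
have eg : g = ext b (Tuple eu) by apply: val_inj.
by case: b E eg => E eg; [left | right]; apply/imsetP;
  exists (Tuple eu) => //; rewrite inE -E.
Qed.

(** [P] accepts words of every length, so it can be pulled back to a path whose last step has been
    removed. *)
Definition num_paths (m n : nat) (P : pred (seq bool)) :=
  #|[set g in Gamma m n | P g]|.

Lemma num_pathsE (m n : nat) (P : pred (seq bool)) :
  num_paths m n P =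
    #|[set g : (m + n).-tuple bool | (path_end g == (m, n)) && P g]|.
Proof. by apply: eq_card => g; rewrite !inE. Qed.

Lemma path_end_rcons (g : seq bool) (s : bool) :
  path_end (rcons g s) = move (path_end g) s.
Proof. by rewrite /path_end foldl_rcons. Qed.

Lemma num_pathsSS (m n : nat) (P : pred (seq bool)) :
  num_paths m.+1 n.+1 P =
    num_paths m n.+1 (fun g => P (rcons g true))
    + num_paths m.+1 n (fun g => P (rcons g false)).
Proof.
rewrite !num_pathsE addSn.
rewrite (card_tuple_rcons _ (fun g => (path_end g == (m.+1, n.+1)) && P g)).
congr (_ + _).
  by apply: eq_card => g; rewrite !inE path_end_rcons; case: (path_end g).
rewrite -addSnnS; apply: eq_card => g.
by rewrite !inE path_end_rcons; case: (path_end g).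
Qed.

Lemma num_pathsS0 (m : nat) (P : pred (seq bool)) :
  num_paths m.+1 0 P = num_paths m 0 (fun g => P (rcons g true)).
Proof.
rewrite !num_pathsE addSn.
rewrite (card_tuple_rcons _ (fun g => (path_end g == (m.+1, 0)) && P g)).
rewrite [X in _ + X]eq_card0 ?addn0.
  by apply: eq_card => g; rewrite !inE path_end_rcons; case: (path_end g).
move=> g; rewrite !inE path_end_rcons; case: (path_end g) => a b.
by rewrite xpair_eqE andbF.
Qed.

Lemma num_paths0S (n : nat) (P : pred (seq bool)) :
  num_paths 0 n.+1 P = num_paths 0 n (fun g => P (rcons g false)).
Proof.
rewrite !num_pathsE add0n.
rewrite (card_tuple_rcons _ (fun g => (path_end g == (0, n.+1)) && P g)).
rewrite [X in X + _]eq_card0 ?add0n.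
  by apply: eq_card => g; rewrite !inE path_end_rcons; case: (path_end g).
by move=> g; rewrite !inE path_end_rcons; case: (path_end g).
Qed.

Lemma num_paths00 (P : pred (seq bool)) : num_paths 0 0 P = P [::].
Proof.
rewrite num_pathsE; have [P0|nP0] := boolP (P [::]).
  rewrite (_ : finset _ = [set [tuple]]) ?cards1 //.
  by apply/setP => g; rewrite tuple0 !inE /= eqxx.
by apply: eq_card0 => g; rewrite tuple0 !inE (negbTE nP0) andbF.
Qed.

Lemma eq_num_paths (m n : nat) (P Q : pred (seq bool)) :
  (forall g, path_end g = (m, n) -> P g = Q g) ->
  num_paths m n P = num_paths m n Q.
Proof.
move=> PQ; rewrite !num_pathsE; apply: eq_card => g; rewrite !inE.
by case: eqP => //= /PQ.
Qed.

Lemma num_paths_pred0 (m n : nat) : num_paths m n (fun=> false) = 0.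
Proof. by rewrite num_pathsE; apply: eq_card0 => g; rewrite !inE andbF. Qed.

(** * Ballot numbers *)

Lemma later_vertices_rcons (g : seq bool) (s : bool) :
  later_vertices (rcons g s)
  = rcons (later_vertices g) (path_end (rcons g s)).
Proof. exact: scanl_rcons. Qed.

Lemma ballotE (p q : nat) :
  ballot p q
  = num_paths p q (fun g => all (fun v => v.2 < v.1) (later_vertices g)).
Proof. by []. Qed.

Lemma ballotSS (p q : nat) :
  ballot p.+1 q.+1 = if q < p then ballot p q.+1 + ballot p.+1 q else 0.
Proof.
rewrite !ballotE num_pathsSS; case: (ltnP q p) => h.
  congr (_ + _); apply: eq_num_paths => g e;
    by rewrite later_vertices_rcons all_rcons path_end_rcons e /=; lia.
(* For [p <= q] the endpoint itself is not strictly below the diagonal, so both classes of paths are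
   empty. *)
rewrite -(num_paths_pred0 p q.+1) -[RHS]addn0 -[in RHS](num_paths_pred0 p.+1 q).
congr (_ + _); apply: eq_num_paths => g e;
  by rewrite later_vertices_rcons all_rcons path_end_rcons e /=; lia.
Qed.

Lemma ballotn0 (p : nat) : ballot p 0 = 1.
Proof.
elim: p => [|p <-]; first by rewrite ballotE num_paths00.
rewrite !ballotE num_pathsS0; apply: eq_num_paths => g e.
by rewrite later_vertices_rcons all_rcons path_end_rcons e.
Qed.

Lemma ballotSn (p : nat) : ballot p.+1 p.+1 = 0.
Proof. by rewrite ballotSS ltnn. Qed.

(** This is the reflection principle, with the paths from (1,0) that touch the diagonal added on the
    left to avoid a subtraction. The proof compares Pascal recursions. *)
Lemma ballot_bin (p q : nat) : q <= p ->
  ballot p.+1 q.+1 + 'C(p + q.+1, q) = 'C(p + q.+1, q.+1).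
Proof.
elim: p q => [|p IHp] q; first by case: q => // _; rewrite ballotSn.
elim: q => [_|q IHq qp].
  rewrite ballotSS ballotn0; case: p IHp => [|p] IHp.
    by rewrite ballotSn.
  by have := IHp 0 isT; rewrite /= !bin0 !bin1; lia.
rewrite ballotSS; case: ltnP => qp'.
  have := IHp q.+1 qp'; have := IHq (ltnW qp).
  rewrite !addSn !addnS !binS; lia.
have -> : p = q by lia.
rewrite add0n -bin_sub; first by congr 'C(_, _); lia.
lia.
Qed.

Lemma ballot_catalan (p : nat) : ballot p.+1 p = catalan p.
Proof.
case: p => [|p]; first by rewrite ballotn0.
have := ballot_bin (leqnSn p); have := catalanE p.+1.
have := mul_bin_left (2 * p.+1) p.
have -> : p.+1 + p.+1 = 2 * p.+1 by lia.
have -> : 2 * p.+1 - p = p.+2 by lia.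
nia.
Qed.

(** * Convolutions over the last diagonal point *)

Definition diag_conv (w : nat -> nat) (x y : nat) : nat :=
  \sum_(i < y.+1) w i * ballot (x - i) (y - i).

Lemma diag_conv0 (w : nat -> nat) (x : nat) : diag_conv w x 0 = w 0.
Proof. by rewrite /diag_conv big_ord1 ballotn0 muln1. Qed.

Lemma diag_convxx (w : nat -> nat) (x : nat) : diag_conv w x x = w x.
Proof.
rewrite /diag_conv big_ord_recr /= subnn ballotn0 muln1 big1 // => i _.
have -> : x - i = (x - i).-1.+1 by have := ltn_ord i; lia.
by rewrite ballotSn muln0.
Qed.

(** Moving (i,i) to the origin turns each term with [i <= y] into the ballot recursion; the term
    [i = y.+1] has ballot number 1 on both sides. *)
Lemma diag_convSS (w : nat -> nat) (x y : nat) : y < x ->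
  diag_conv w x.+1 y.+1 = diag_conv w x y.+1 + diag_conv w x.+1 y.
Proof.
move=> yx; rewrite /diag_conv big_ord_recr [X in _ = X + _]big_ord_recr /=.
rewrite !subnn !ballotn0 addnAC -big_split /=; congr (_ + _).
apply: eq_bigr => i _; rewrite -mulnDr; congr (_ * _).
have le_iy : i <= y by rewrite -ltnS.
rewrite !subSn ?(leq_trans le_iy) // 1?ltnW //.
by rewrite ballotSS ltn_sub2r // (leq_ltn_trans le_iy).
Qed.

(** The summation index is the height of the horizontal edge from [x = c] to
    [x = c.+1]. *)
Lemma diag_conv_column (w : nat -> nat) (c d y : nat) : y <= c ->
  diag_conv w (c.+1 + d) y
  = \sum_(j < y.+1) 'C(d + (y - j), d) * diag_conv w c j.
Proof.
elim: d y => [|d IHd] y.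
  rewrite addn0; elim: y => [_|y IHy yc].
    by rewrite big_ord1 bin0 mul1n !diag_conv0.
  rewrite diag_convSS // IHy; last exact: ltnW.
  rewrite [RHS]big_ord_recr /= addnC bin0 mul1n; congr (_ + _).
  by apply: eq_bigr => j _; rewrite !bin0.
elim: y => [_|y IHy yc].
  by rewrite big_ord1 addn0 binn mul1n !diag_conv0.
rewrite addnS diag_convSS; last by lia.
rewrite IHd // -addnS IHy; last exact: ltnW.
rewrite [RHS]big_ord_recr [X in X + _ = _]big_ord_recr /= !subnn !addn0 !binn.
rewrite addnAC -big_split /=; congr (_ + _); apply: eq_bigr => j _.
have le_jy : j <= y by rewrite -ltnS.
by rewrite -mulnDl subSn // !addnS !addSn [in RHS]binS [in RHS]addnC.
Qed.

Lemma diag_conv_central_bin (x y : nat) : y <= x ->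
  diag_conv (fun i => 'C(2 * i, i)) x y = 'C(x + y, y).
Proof.
elim: x y => [|x IHx] y; first by case: y => // _; rewrite diag_conv0.
elim: y => [_|y IHy]; first by rewrite diag_conv0 !bin0.
rewrite ltnS leq_eqVlt => /orP[/eqP->|yx].
  by rewrite diag_convxx; congr 'C(_, _); lia.
rewrite diag_convSS // IHx // IHy; last by lia.
by rewrite [in RHS]addSn [in RHS]binS !addnS !addSn; lia.
Qed.

(** * The Catalan convolution and its truncations *)

Lemma catalanS (n : nat) :
  catalan n.+1 = \sum_(i < n.+1) catalan i * catalan (n - i).
Proof.
set S := (RHS).
have H : \sum_(i < n.+1) i.+1 * (catalan i * catalan (n - i))
         = 'C(n.+1 + n, n).
  rewrite -diag_conv_central_bin //; apply: eq_bigr => i _.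
  have le_in : i <= n by rewrite -ltnS.
  by rewrite subSn // ballot_catalan -catalanE mulnA.
(* This is [H] after the reversal [i -> n - i]; in the sum of the two, every term carries the same
   factor [n.+2]. *)
have H' : \sum_(i < n.+1) (n - i).+1 * (catalan i * catalan (n - i))
         = 'C(n.+1 + n, n).
  rewrite -H (reindex_inj rev_ord_inj) /=; apply: eq_bigr => i _.
  have le_in : i <= n by rewrite -ltnS.
  by rewrite subSS subKn // [catalan i * _]mulnC.
have E : n.+2 * S = 'C(2 * n.+1, n.+1).
  transitivity ('C(n.+1 + n, n) + 'C(n.+1 + n, n)).
    rewrite -{1}H -H' -big_split big_distrr /=; apply: eq_bigr => i _.
    by rewrite -mulnDl; congr (_ * _); have := ltn_ord i; lia.
  have -> : 2 * n.+1 = (n.+1 + n).+1 by lia.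
  rewrite binS -[in X in _ = X + _]bin_sub; last by lia.
  by rewrite addSn subSS addnK.
by apply/eqP; rewrite -(eqn_pmul2l (ltn0Sn n.+1)) catalanE E.
Qed.

(** By Chung-Feller, this is the number of paths to (i,i) with exactly [r] horizontal edges above
    the diagonal, and equally with exactly [r] below. *)
Definition catalan_from (r i : nat) : nat := (r <= i) * catalan i.

(** After reversing the first sum its condition becomes [i < r], the complement of [r <= i], so each
    term of the Catalan convolution is kept exactly once. *)
Lemma diag_conv_catalan_from (c r s : nat) : r + s = c.+1 ->
  diag_conv (catalan_from s) c.+1 c + diag_conv (catalan_from r) c.+1 c
  = catalan c.+1.
Proof.
move=> rs; rewrite catalanS /diag_conv (reindex_inj rev_ord_inj) -big_split /=.
apply: eq_bigr => i _; have le_ic : i <= c by rewrite -ltnS.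
rewrite /catalan_from subSS !subSn ?leq_subr // !ballot_catalan subKn //.
by case: (leqP r i) => h; case: leqP => h'; lia.
Qed.

(** This is the column decomposition one row higher, at [y = c.+1]. The edge leaving column [c] may
    now have height [c.+1], above the line; reflection turns that case into the first term. *)
Lemma diag_conv_exit (c d r s : nat) : r + s = c.+1 ->
  diag_conv (catalan_from s) c.+1 c
  + \sum_(j < c.+1) 'C(d + (c.+1 - j), d) * diag_conv (catalan_from r) c j
  = diag_conv (catalan_from r) (c.+1 + d) c.+1.
Proof.
move=> rs; elim: d => [|d IHd].
  rewrite addn0 diag_convxx /catalan_from (_ : r <= c.+1); last by lia.
  rewrite mul1n -(diag_conv_catalan_from rs).
  have := diag_conv_column (catalan_from r) 0 (leqnn c).
  rewrite addn0 => ->; congr (_ + _).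
  by apply: eq_bigr => j _; rewrite !bin0.
rewrite addnS diag_convSS; last by lia.
rewrite -IHd -addnS diag_conv_column // -addnA; congr (_ + _).
rewrite -big_split /=.
apply: eq_bigr => j _; have le_jc : j <= c by rewrite -ltnS.
by rewrite -mulnDl subSn // !addnS !addSn [in LHS]binS addnC.
Qed.

Lemma diag_conv_catalan_from0 (r x y : nat) : y < r ->
  diag_conv (catalan_from r) x y = 0.
Proof.
move=> yr; apply: big1 => i _.
by rewrite /catalan_from leqNgt (leq_trans (ltn_ord i)).
Qed.

(** * Exceedance under removal of the last step *)

(** No step follows the final vertex; dropping it gives [mask] two lists of equal length, as
    [mask_rcons] requires. *)
Lemma hedgesE (g : seq bool) :
  hedges g = mask g (belast (0, 0) (later_vertices g)).
Proof.
rewrite /hedges lastI -cats1 -{1}[g]cats0 mask_cat ?cats0 //.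
by rewrite size_belast size_scanl.
Qed.

Lemma hedges_rcons (g : seq bool) (s : bool) :
  hedges (rcons g s) = hedges g ++ nseq s (path_end g).
Proof.
rewrite hedgesE later_vertices_rcons belast_rcons lastI mask_rcons; last first.
  by rewrite size_belast size_scanl.
rewrite -hedgesE; congr (_ ++ nseq _ _).
by case/lastP: g => // g t; rewrite later_vertices_rcons last_rcons.
Qed.

Lemma size_hedges (g : seq bool) : size (hedges g) = (path_end g).1.
Proof.
elim/last_ind: g => // g s IHg.
rewrite hedges_rcons size_cat size_nseq IHg path_end_rcons.
by case: s => /=; rewrite ?addn1 ?addn0.
Qed.

Lemma HE_rcons_up (k : nat) (g : seq bool) : HE k (rcons g false) = HE k g.
Proof. by rewrite /HE hedges_rcons cats0. Qed.

Lemma HE_rcons_right (k x y : nat) (g : seq bool) : path_end g = (x, y) ->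
  HE k (rcons g true) = HE k g + (x < k) * (y <= x).
Proof.
move=> e; rewrite /HE hedges_rcons take_cat size_hedges e /=.
case: ltngtP => [kx|xk|->]; rewrite ?addn0 ?subnn ?take0 ?cats0 //.
  have -> : take (k - x) [:: (x, y)] = [:: (x, y)].
    by rewrite take_oversize //= subn_gt0.
  rewrite count_cat take_oversize ?size_hedges ?e ?(ltnW xk) //=.
by rewrite take_oversize // size_hedges e.
Qed.

(** * Paths of given exceedance *)

Definition exc_paths (k x y l : nat) : nat :=
  num_paths x y (fun g => HE k g == l).

Lemma exc_paths0n (k y l : nat) : exc_paths k 0 y l = (l == 0).
Proof.
elim: y => [|y IHy].
  by rewrite /exc_paths num_paths00 /HE /= eq_sym.
rewrite /exc_paths num_paths0S -IHy; apply: eq_num_paths => g _.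
by rewrite HE_rcons_up.
Qed.

Lemma exc_pathsS0 (k x l : nat) :
  exc_paths k x.+1 0 l = num_paths x 0 (fun g => HE k g + (x < k) == l).
Proof.
rewrite /exc_paths num_pathsS0; apply: eq_num_paths => g e.
by rewrite (HE_rcons_right _ e) muln1.
Qed.

Lemma exc_pathsSS (k x y l : nat) :
  exc_paths k x.+1 y.+1 l =
    num_paths x y.+1 (fun g => HE k g + (x < k) * (y < x) == l)
    + exc_paths k x.+1 y l.
Proof.
rewrite /exc_paths num_pathsSS; congr (_ + _); apply: eq_num_paths => g e.
  by rewrite (HE_rcons_right _ e).
by rewrite HE_rcons_up.
Qed.

Lemma num_paths_HE0 (k x y l : nat) :
  num_paths x y (fun g => HE k g + 0 == l) = exc_paths k x y l.
Proof. by apply: eq_num_paths => g _; rewrite addn0. Qed.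

Lemma num_paths_HE1 (k x y l : nat) :
  num_paths x y (fun g => HE k g + 1 == l) =
    if l is l'.+1 then exc_paths k x y l' else 0.
Proof.
case: l => [|l]; last by apply: eq_num_paths => g _; rewrite addn1.
rewrite -[RHS](num_paths_pred0 x y).
by apply: eq_num_paths => g _; rewrite addn1.
Qed.

Lemma exc_paths_oversize (k x y l : nat) :
  x <= k -> x < l -> exc_paths k x y l = 0.
Proof.
elim: x y l => [|x IHx] y l xk; first by rewrite exc_paths0n; case: l.
case: l => // l xl; elim: y => [|y IHy].
  by rewrite exc_pathsS0 xk num_paths_HE1 IHx // ltnW.
rewrite exc_pathsSS IHy xk mul1n addn0.
by case: ltnP => _; rewrite ?num_paths_HE1 ?num_paths_HE0 IHx // ltnW.
Qed.

(** Within the first [k] horizontal edges, a path with [l] edges below has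
    [x - l] above; a path ending below the line has as many vertical as horizontal
    edges above it, which is why reflection exchanges the two formulas. *)
Lemma exc_paths_catalan_from (k x y l : nat) : x <= k ->
  (forall r, y <= x -> l + r = x ->
     exc_paths k x y l = diag_conv (catalan_from r) x y)
  /\ (x <= y -> exc_paths k x y l = diag_conv (catalan_from l) y x).
Proof.
elim: x y l => [|x IHx] y l xk.
  rewrite exc_paths0n; split=> [r|_].
    rewrite leqn0 => /eqP-> /eqP; rewrite addn_eq0 => /andP[/eqP-> /eqP->].
    by rewrite diag_conv0.
  by rewrite diag_conv0 /catalan_from leqn0 muln1.
have IHxA y' l' r : y' <= x -> l' + r = x ->
    exc_paths k x y' l' = diag_conv (catalan_from r) x y'.
  by have [+ _] := IHx y' l' (ltnW xk); apply.
have IHxB y' l' : x <= y' ->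
    exc_paths k x y' l' = diag_conv (catalan_from l') y' x.
  by have [_] := IHx y' l' (ltnW xk).
elim: y => [|y [IHyA IHyB]].
  split=> // r _ lr; rewrite exc_pathsS0 xk num_paths_HE1 diag_conv0.
  case: l lr => [|l] lr; first by rewrite /catalan_from; case: r lr.
  by case: lr => lr; rewrite (IHxA 0 l r) // diag_conv0.
have [yx|xy|yx] := ltngtP y x.
- split; last by lia.
  move=> r _ lr; rewrite exc_pathsSS xk yx (IHyA r) // 1?ltnW //; last by lia.
  rewrite diag_convSS // num_paths_HE1; congr (_ + _).
  (* A path ending with a right step below the line has positive exceedance; for [l = 0] the
     convolution vanishes too, because [r = x.+1] exceeds [y.+1]. *)
  case: l lr {IHyA IHyB} => [|l] lr.
    by rewrite diag_conv_catalan_from0 //; lia.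
  by rewrite (IHxA y.+1 l r) //; lia.
- split; first by lia.
  move=> _; rewrite exc_pathsSS (leq_gtF (ltnW xy)) muln0 num_paths_HE0.
  by rewrite diag_convSS // IHyB // IHxB 1?addnC //; lia.
- rewrite yx in IHyA IHyB *.
  (* The two predecessors lie on opposite sides of the diagonal, so both formulas are needed; their
     sum is the split Catalan convolution. *)
  have A r : l + r = x.+1 -> exc_paths k x.+1 x.+1 l = catalan x.+1.
    move=> lr; rewrite exc_pathsSS ltnn muln0 num_paths_HE0.
    by rewrite (IHyA r) // IHxB // diag_conv_catalan_from //; lia.
  split=> [r _ lr|_]; first by rewrite (A r) // diag_convxx /catalan_from; lia.
  rewrite diag_convxx /catalan_from; case: (leqP l x.+1) => h.
    by rewrite mul1n (A (x.+1 - l)) // subnKC.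
  by rewrite exc_paths_oversize.
Qed.

(** Edges beyond column [k] leave the exceedance unchanged, so both sides follow the plain Pascal
    recursion from column [k] on. *)
Lemma exc_paths_right (k d y l r : nat) : y <= k -> l + r = k ->
  exc_paths k (k + d) y l = diag_conv (catalan_from r) (k + d) y.
Proof.
move=> yk lr; elim: d y yk => [|d IHd] y yk.
  by have [+ _] := exc_paths_catalan_from y l (leqnn k); rewrite addn0; apply.
have kd : (k + d < k) = false by lia.
rewrite addnS; elim: y yk => [_|y IHy yk].
  by rewrite exc_pathsS0 kd num_paths_HE0 IHd // !diag_conv0.
rewrite exc_pathsSS kd num_paths_HE0 IHd // IHy; last exact: ltnW.
by rewrite diag_convSS //; lia.
Qed.

(** The sums sort paths by how they leave the square of side [c]: up from (j,c), after which the
    rest of the first [c.+1] horizontal edges are above the line, or right from (c,j), by an edge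
    below it. *)
Lemma exc_paths_exit (c a b l r : nat) : l + r = c.+1 ->
  exc_paths c.+1 (c.+1 + a) (c.+1 + b) l =
    \sum_(j < c.+1) 'C(b + (a + c.+1 - j), b) * diag_conv (catalan_from l) c j
    + \sum_(j < c.+1)
        'C(a + (b + c.+1 - j), a) * diag_conv (catalan_from r) c j.
Proof.
move=> lr.
(* When [a = 0] or [b = 0], the binomials of one sum are all 1 and that sum collapses to a single
   convolution. *)
have col0 w : \sum_(j < c.+1) diag_conv w c j = diag_conv w c.+1 c.
  have := diag_conv_column w 0 (leqnn c); rewrite addn0 => ->.
  by apply: eq_bigr => j _; rewrite bin0 mul1n.
elim: a b => [|a IHa] b.
  rewrite addn0.
  have [_ ->] := exc_paths_catalan_from (c.+1 + b) l (leqnn c.+1);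
    last exact: leq_addr.
  rewrite -(diag_conv_exit _ lr) addnC; congr (_ + _).
  by rewrite -col0; apply: eq_bigr => j _; rewrite bin0 mul1n.
elim: b => [|b IHb].
  rewrite addn0 (exc_paths_right _ _ lr) //.
  rewrite -(@diag_conv_exit c a.+1 r l); last by lia.
  by congr (_ + _); rewrite -col0; apply: eq_bigr => j _; rewrite bin0 mul1n.
have kd : (c.+1 + a < c.+1) = false by lia.
rewrite !addnS exc_pathsSS kd num_paths_HE0 -!addnS IHa IHb addnACA.
congr (_ + _); rewrite -big_split /=; apply: eq_bigr => j _;
  have jc := ltn_ord j; rewrite -mulnDl; congr (_ * _).
  have -> : b.+1 + (a.+1 + c.+1 - j) = (b + (a + c.+1 - j)).+2 by lia.
  rewrite [RHS]binS; congr ('C(_, _) + 'C(_, _)); lia.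
have -> : a.+1 + (b.+1 + c.+1 - j) = (a + (b + c.+1 - j)).+2 by lia.
rewrite [RHS]binS addnC; congr ('C(_, _) + 'C(_, _)); lia.
Qed.

(** * Matching the stated formulas *)

Lemma diag_conv_catalan_from_nat (r c j : nat) :
  diag_conv (catalan_from r) c j
  = \sum_(r <= i < j.+1) catalan i * ballot (c - i) (j - i).
Proof.
rewrite big_geq_mkord big_mkcond; apply: eq_bigr => i _.
by rewrite /catalan_from; case: leqP => _; rewrite ?mul1n.
Qed.

(** The separate case [j = k - 1] obeys the general formula: among the ballot numbers on the
    diagonal only [ballot 0 0] is nonzero. *)
Lemma B_jkE (m n j c l : nat) : c < m -> c < n -> l <= j -> j <= c ->
  B_jk m n j c.+1 l
  = 'C(m + n - c.+1 - j, n - c.+1) * diag_conv (catalan_from l) c j.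
Proof.
move=> cm cn lj jc; rewrite /B_jk subn1 /=; case: eqP => [ej|_]; last first.
  by rewrite diag_conv_catalan_from_nat.
rewrite ej in lj *; rewrite diag_convxx /catalan_from lj mul1n.
by congr ('C(_, _) * _); lia.
Qed.

Lemma B_kjE (m n j c l : nat) : B_kj m n c.+1 j l = B_jk n m j c.+1 (c.+1 - l).
Proof. by rewrite /B_kj /B_jk (addnC n). Qed.

Theorem theorem2p7 (m n k l : nat) (k_ge1 : 1 <= k) (k_le : k <= minn m n)
    (l_le : l <= k) :
  #|[set g in Gamma m n | HE k g == l]| =
    \sum_(0 <= j < k) (l <= j) * B_jk m n j k l
    + \sum_(0 <= j < k) (k - l <= j) * B_kj m n k j l.
Proof.
case: k k_ge1 k_le l_le => // c _; rewrite leq_min => /andP[km kn] lk.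
transitivity (exc_paths c.+1 (c.+1 + (m - c.+1)) (c.+1 + (n - c.+1)) l).
  by rewrite !subnKC.
rewrite (exc_paths_exit _ _ (subnKC lk)) !big_mkord.
congr (_ + _); apply: eq_bigr => j _; have jc : j <= c by rewrite -ltnS.
  (* The indicator is already built into the weight: the convolution vanishes when [j < l]. *)
  case: leqP => lj; last by rewrite diag_conv_catalan_from0 ?muln0.
  rewrite mul1n B_jkE //; congr ('C(_, _) * _); lia.
case: leqP => lj; last by rewrite diag_conv_catalan_from0 ?muln0.
rewrite mul1n B_kjE B_jkE //; congr ('C(_, _) * _); lia.
Qed.
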